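(* Let $q$ be a fixed prime power, let $0<\delta\leq 1-\frac1q$, and let $H$ be a fixed graph. Then, as $n\to\infty$, $$\mathrm{inj}\left(H,\Gamma_{<\delta n}(\mathbb{F}_q^n)\right)\in (q^n)^{v(H)-e(H)+e(H)h_q(\delta)+o(1)+\mathbb R_{\geq0}};$$ that is, there is a function $\varepsilon(n)\to0$ (depending on $q,\delta,H$) such that for all sufficiently large $n$, $$\mathrm{inj}\left(H,\Gamma_{<\delta n}(\mathbb{F}_q^n)\right)\ \geq\ (q^n)^{v(H)-e(H)+e(H)h_q(\delta)+\varepsilon(n)}.$$
   Context: Graphs are finite and simple; $v(H)$ and $e(H)$ are the numbers of vertices and edges of $H$. $\mathrm{inj}(H,G)$ is the number of injective graph homomorphisms from $H$ to $G$ (injective maps $V(H)\to V(G)$ sending edges to edges). $\mathbb{F}_q^n$ carries the Hamming metric $d_H(u,w)=|\{i:u_i\neq w_i\}|$. The proximity graph $\Gamma_{<\delta n}(\mathbb{F}_q^n)$ has vertex set $\mathbb{F}_q^n$, with two distinct vectors $u,w$ adjacent if and only if $d_H(u,w)<\delta n$. The function $h_q$ is $$h_q(\delta)=-(1-\delta)\log_q(1-\delta)-\delta\log_q\left(\frac{\delta}{q-1}\right).$$ In the exponent, $\mathbb R_{\geq 0}$ denotes the set of nonnegative real-valued functions (of $n$); writing $f\in g^{A+B}$ for sets of functions $A,B$ means $f=g^{a+b}$ for some $a\in A$, $b\in B$. *)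

(* Defs.v *)
From HB Require Import structures.
From mathcomp Require Import all_boot all_order all_algebra.
From mathcomp Require Import all_classical all_reals all_analysis.
Set Implicit Arguments.
Unset Strict Implicit.
Unset Printing Implicit Defensive.
Import Order.TTheory GRing.Theory Num.Theory.
Import numFieldNormedType.Exports.
Local Open Scope ring_scope.

Record sgraph := SGraph {
  vertex :> finType;
  adj : rel vertex;
  adj_sym : symmetric adj;
  adj_irr : irreflexive adj }.

Definition edges (G : sgraph) : {set {set G}} :=
  [set [set p.1; p.2] | p : G * G & adj p.1 p.2]%SET.

Definition numv (G : sgraph) : nat := #|G|.
Definition nume (G : sgraph) : nat := #|edges G|.

Definition injhom (H G : sgraph) : {set {ffun H -> G}} :=
  [set f : {ffun H -> G} | injectiveb f
    & [forall x, forall y, adj x y ==> adj (f x) (f y)]]%SET.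

Definition inj_num (H G : sgraph) : nat := #|injhom H G|.

Definition prime_power (q : nat) : Prop :=
  exists p k : nat, [/\ prime p, (0 < k)%N & q = (p ^ k)%N].

Definition hamming (F : finFieldType) (n : nat) (u w : 'rV[F]_n) : nat :=
  #|[set i : 'I_n | u 0 i != w 0 i]%SET|.

Section Proximity.
Variables (R : realType) (F : finFieldType) (delta : R) (n : nat).

Definition prox_adj : rel 'rV[F]_n :=
  [rel u w | (u != w) && ((hamming u w)%:R < delta * n%:R)].

Lemma hammingC (u w : 'rV[F]_n) : hamming u w = hamming w u.
Proof. by congr #|pred_of_set _|; apply/setP => i; rewrite !inE eq_sym. Qed.

Lemma prox_adj_sym : symmetric prox_adj.
Proof. by move=> u w; rewrite /prox_adj /= eq_sym hammingC. Qed.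

Lemma prox_adj_irr : irreflexive prox_adj.
Proof. by move=> u; rewrite /prox_adj /= eqxx. Qed.

Definition proximity : sgraph := SGraph prox_adj_sym prox_adj_irr.
End Proximity.
Arguments proximity {R} F delta n.

Definition logb (R : realType) (b : nat) (x : R) : R := ln x / ln b%:R.

Definition hq (R : realType) (q : nat) (delta : R) : R :=
  - (1 - delta) * logb q (1 - delta) - delta * logb q (delta / (q%:R - 1)).

(* Main.v *)
Require Import Defs.
From HB Require Import structures.
From mathcomp Require Import all_boot all_order all_algebra.
From mathcomp Require Import all_classical all_reals all_analysis.
From mathcomp Require Import ring lra.
Import Order.TTheory GRing.Theory Num.Theory.
Import numFieldNormedType.Exports.
Local Open Scope classical_set_scope.
Local Open Scope ring_scope.

(** The count is obtained from a ferromagnetic Potts model on [H].  Give a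
colouring [c : V(H) -> F] the weight [\prod_i exp (- lam i)] over the edges [i]
whose two ends get different colours, and let [Z] be the sum of all weights.
A sequence of [n] colourings is the same thing as a map [V(H) -> F^n], and the
number of colourings in it that disagree on an edge is the Hamming distance
between the images of the two ends.

The parameters [lam i >= 0] are chosen to minimise
[ln Z + delta * \sum_i lam i].  The optimality conditions say that under the
Potts measure each edge [i] disagrees with probability at most [delta], and with
probability exactly [delta] when [lam i > 0] ([exists_balanced_weights], which
minimises over a grid of step [s] and leaves a margin of order [s]).  By
exponential moment bounds, a sequence of [n] independent colourings then
typically gives an injective map all of whose edges are shorter than [delta n],
while edges with [lam i > 0] have length about [delta n] ([typical_mass]).  Such
a sequence has weight about [exp (- n * delta * \sum_i lam i)] at most, and the
typical ones have total weight at least [Z ^+ n / 2], so there are at least about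
[(Z * exp (delta * \sum_i lam i)) ^+ n] of them ([many_close_injections]).

It remains to bound [Z] below.  The inequality
[q ^+ v(H) * \prod_i (w i + (1 - w i) / q) <= Z], with [w i = exp (- lam i)]
([partition_fn_ge]), says that for these weights [H] behaves no worse than if its
edges were independent: expanding the product of
[w i + (1 - w i) * [c agrees on i]], it reduces to the fact that [k] equations
[c x = c y] cut the number of colourings by a factor at most [q ^+ k].  Finally
each factor [(1 + (q - 1) * w i) / q * exp (delta * lam i)] is at least
[q ^ (hq delta - 1)], because [hq delta * ln q] is the minimum over [lam] of
[ln (1 + (q - 1) * exp (- lam)) + delta * lam] ([entropy_duality]).  Multiplying over
the edges gives the exponent [v(H) - e(H) + e(H) * hq delta], up to an error that
vanishes with [s]. *)

(** * Exponential moments and entropy *)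

Section ExpBounds.
Variable R : realType.
Implicit Types (d s t Z D x y lam theta : R).

Lemma expRB1_le t : expR t - 1 <= t * expR t.
Proof.
have := expR_ge1Dx (- t); rewrite -(ler_pM2r (expR_gt0 t)) -expRD addNr expR0.
rewrite mulrDl mul1r mulNr; lra.
Qed.

Lemma expRB1_ge t : t <= expR t - 1.
Proof. have := expR_ge1Dx t; lra. Qed.

(** [Z] stands for a total mass and [D] for the mass of an event of probability at
most [x]; the left-hand side is the integral of [exp (t * (1_D - y))].  That it
stays below [Z] makes frequencies above [y] exponentially rare. *)
Lemma chernoff_upper t Z D x y : 0 < t -> 0 < Z -> 0 <= x ->
  D <= x * Z -> x * expR t < y ->
  expR (- (t * y)) * (Z + (expR t - 1) * D) < Z.
Proof.
move=> t0 Z0 x0 Dx xy; rewrite expRN ltr_pdivrMl ?expR_gt0 // [_ * Z]mulrC.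
have H : (expR t - 1) * D <= t * expR t * (x * Z).
  apply: (@le_trans _ _ ((expR t - 1) * (x * Z))).
    by rewrite ler_wpM2l // (le_trans (ltW t0) (expRB1_ge t)).
  by rewrite ler_wpM2r ?expRB1_le // mulr_ge0 // ltW.
apply: (@lt_le_trans _ _ (Z * (1 + t * y))).
  apply: le_lt_trans (lerD (lexx Z) H) _.
  have -> : Z + t * expR t * (x * Z) = Z * (1 + t * (x * expR t)) by ring.
  by rewrite ltr_pM2l // ltrD2l ltr_pM2l.
by rewrite ler_pM2l // expR_ge1Dx.
Qed.

(** The mirror image, for frequencies below [y < x]. *)
Lemma chernoff_lower t Z D x y : 0 < t -> 0 < Z -> 0 <= x ->
  x * Z <= D -> y < x * expR (- t) ->
  expR (t * y) * (Z + (expR (- t) - 1) * D) < Z.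
Proof.
move=> t0 Z0 x0 Dx xy; rewrite -[t * y]opprK [expR (- - _)]expRN.
rewrite ltr_pdivrMl ?expR_gt0 // [_ * Z]mulrC.
have u0 : 0 <= 1 - expR (- t) by rewrite subr_ge0 expR_le1 oppr_le0 ltW.
have H : t * expR (- t) * (x * Z) <= (1 - expR (- t)) * D.
  apply: (@le_trans _ _ ((1 - expR (- t)) * (x * Z))); last by rewrite ler_wpM2l.
  apply: ler_wpM2r; first by rewrite mulr_ge0 // ltW.
  by have := expRB1_le (- t); rewrite mulNr => ?; lra.
apply: (@lt_le_trans _ _ (Z * (1 - t * y))).
  have -> : Z + (expR (- t) - 1) * D = Z - (1 - expR (- t)) * D by ring.
  apply: le_lt_trans (lerB (lexx Z) H) _.
  have -> : Z - t * expR (- t) * (x * Z) = Z * (1 - t * (x * expR (- t))) by ring.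
  by rewrite ltr_pM2l // ltrD2l ltrN2 ltr_pM2l.
by rewrite ler_pM2l // -mulrN mulrN; exact: expR_ge1Dx.
Qed.

(** Gibbs' inequality for the law with masses [1 / T] and [(q - 1) * exp (- lam) / T],
where [T = 1 + (q - 1) * exp (- lam)], compared with the law with masses [1 - d] and
[d]; it follows from [ln x - ln y <= (x - y) / y] applied to both masses, whose
differences cancel. *)
Lemma entropy_duality (q : R) d lam : 1 < q -> 0 < d < 1 ->
  - (1 - d) * ln (1 - d) - d * ln (d / (q - 1))
    <= ln (1 + (q - 1) * expR (- lam)) + d * lam.
Proof.
move=> q1 /andP[d0 d1]; set T := 1 + (q - 1) * _.
have e0 := expR_gt0 (- lam).
have T0 : 0 < T by rewrite /T addr_gt0 // mulr_gt0 // subr_gt0.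
have ln_le (x y : R) : 0 < x -> 0 < y -> y * (ln x - ln y) <= x - y.
  move=> x0 y0; rewrite -ln_div ?posrE // mulrC -ler_pdivlMr // mulrBl divff ?gt_eqF //.
  have := @le_ln1Dx R (x / y - 1); rewrite addrCA subrr addr0; apply.
  by rewrite ltrBrDr addNr divr_gt0.
have e0' : 0 < (q - 1) * expR (- lam) by rewrite mulr_gt0 // subr_gt0.
have d1' : 0 < 1 - d by rewrite subr_gt0.
have q1' : 0 < q - 1 by rewrite subr_gt0.
have H1 := ln_le T^-1 (1 - d) _ d1'; have H2 := ln_le ((q - 1) * expR (- lam) / T) d _ d0.
rewrite invr_gt0 in H1; have {}H1 := H1 T0.
rewrite divr_gt0 // in H2; have {}H2 := H2 isT.
rewrite lnV ?posrE // in H1.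
rewrite ln_div ?posrE // lnM ?posrE // ?expR_gt0 // expRK in H2.
have E : T^-1 - (1 - d) + ((q - 1) * expR (- lam) / T - d) = 0.
  have E1 : T^-1 + (q - 1) * expR (- lam) / T = 1.
    by rewrite -[X in X + _]mul1r -mulrDl divff ?gt_eqF.
  by lra.
rewrite ln_div ?posrE //; nra.
Qed.

(** The contribution of one edge to the exponent.  The factor [theta], later close
to [1], is the loss incurred because an edge of positive parameter is only known
to disagree with frequency at least [theta * d]; since
[ln (1 + (q - 1) * exp (- lam)) >= 0], it costs no more than a factor [theta] in the
entropy. *)
Lemma edge_factor_ge (q : R) d lam theta : 1 < q -> 0 < d < 1 -> 0 <= theta <= 1 ->
  expR (theta * (- (1 - d) * ln (1 - d) - d * ln (d / (q - 1))) - ln q)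
    <= (expR (- lam) + (1 - expR (- lam)) / q) * expR (theta * d * lam).
Proof.
move=> q1 d01 /andP[th0 th1]; have := entropy_duality q d lam q1 d01.
set h := - (1 - d) * _ - _; set T := 1 + (q - 1) * _ => hT.
have e0 := expR_gt0 (- lam).
have q0 : 0 < q by lra.
have T1 : 1 <= T by rewrite lerDl mulr_ge0 // ?subr_ge0 ltW.
have lnT0 : 0 <= ln T by rewrite ln_ge0.
have -> : expR (- lam) + (1 - expR (- lam)) / q = expR (ln T - ln q).
  rewrite expRB !lnK ?posrE ?(lt_le_trans _ T1) // /T.
  by field; lra.
rewrite -expRD ler_expR; have := ler_wpM2l th0 hT; nra.
Qed.

End ExpBounds.

(** * Typical points of a product measure *)

Section ProductMeasure.
Variables (R : realType) (C J : finType) (W : C -> R) (g : J -> C -> R).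
Hypotheses (W_ge0 : forall c, 0 <= W c) (g_ge0 : forall j c, 0 <= g j c).

Lemma sum_prod_ffun (G : C -> R) n :
  \sum_(y : {ffun 'I_n -> C}) \prod_k G (y k) = (\sum_c G c) ^+ n.
Proof.
have := bigA_distr_bigA (zero := 0) (plus := +%R) (one := 1) (times := *%R)
  (fun (k : 'I_n) c => G c).
by move=> <-; rewrite prodr_const card_ord.
Qed.

(** Each [g j] is the one-coordinate factor of a product that is at least [1] on the
event to be avoided: an exponential moment, or the indicator of a collision. *)
Definition typical {n} (y : {ffun 'I_n -> C}) :=
  [forall j, \prod_k g j (y k) < 1].

(** Markov's inequality for each of the products, and a union bound. *)
Lemma atypical_mass n :
  \sum_(y : {ffun 'I_n -> C} | ~~ typical y) \prod_k W (y k)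
    <= \sum_j (\sum_c g j c * W c) ^+ n.
Proof.
under [X in _ <= X]eq_bigr => j _ do rewrite -sum_prod_ffun.
rewrite exchange_big /= big_mkcond; apply: ler_sum => y _.
have gW0 j : 0 <= \prod_k (g j (y k) * W (y k)).
  by apply: prodr_ge0 => k _; exact: mulr_ge0.
case: ifPn => [|_]; last exact: sumr_ge0.
case/forallPn => j; rewrite -leNgt => gj.
rewrite (bigD1 j) //= -[X in X <= _]addr0 lerD //; last exact: sumr_ge0.
by rewrite big_split /= ler_peMl // prodr_ge0.
Qed.

(** When each [g j] has mean below [1], the bound of [atypical_mass] is a finite sum of
terms exponentially small compared with the total mass. *)
Lemma typical_mass : 0 < \sum_c W c ->
    (forall j, \sum_c g j c * W c < \sum_c W c) ->
  \forall n \near \oo,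
    (\sum_c W c) ^+ n / 2
      <= \sum_(y : {ffun 'I_n -> C} | typical y) \prod_k W (y k).
Proof.
set Z := \sum_c W c => Z0 gZ.
pose e : R := (2 * #|J|.+1%:R)^-1.
have e0 : 0 < e by rewrite invr_gt0 mulr_gt0.
have small j : \forall n \near \oo, (\sum_c g j c * W c) ^+ n <= Z ^+ n * e.
  have r0 : 0 <= (\sum_c g j c * W c) / Z.
    apply: divr_ge0 (ltW Z0); apply: sumr_ge0 => c _; exact: mulr_ge0.
  have r1 : `|(\sum_c g j c * W c) / Z| < 1.
    by rewrite ger0_norm // ltr_pdivrMr // mul1r.
  have /(_ _ e e0) := (cvgrPdist_lt _ _).1 (cvg_expr r1).
  apply: filterS => n; rewrite sub0r normrN ger0_norm ?exprn_ge0 // => /ltW.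
  by rewrite expr_div_n ler_pdivrMr ?exprn_gt0 // mulrC.
have all_small : \forall n \near \oo, forall j,
    (\sum_c g j c * W c) ^+ n <= Z ^+ n * e by apply: filter_forall.
apply: filterS all_small => n smalln.
have total : Z ^+ n = \sum_(y : {ffun 'I_n -> C} | typical y) \prod_k W (y k)
    + \sum_(y : {ffun 'I_n -> C} | ~~ typical y) \prod_k W (y k).
  by rewrite -sum_prod_ffun (bigID typical).
have bad : \sum_(y : {ffun 'I_n -> C} | ~~ typical y) \prod_k W (y k) <= Z ^+ n / 2.
  apply: le_trans (atypical_mass n) _; apply: le_trans.
    by apply: ler_sum => j _; exact: smalln.
  rewrite sumr_const -[_ *+ _]mulr_natr -mulrA.
  apply: ler_wpM2l; first by rewrite exprn_ge0 // ltW.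
  rewrite /e invfM -mulrA ger_pMr ?invr_gt0 // mulrC ler_pdivrMr // mul1r.
  by rewrite ler_nat.
lra.
Qed.

End ProductMeasure.

Arguments typical {R C J} g {n} y.

(** * The Potts model of a graph *)

Section Potts.
Variables (R : realType) (F : finFieldType) (V I : finType) (a b : I -> V).
Implicit Types (c : {ffun V -> F}) (w : I -> R) (s : seq I).
Local Notation q := (#|F|%:R : R).

Definition disagree c i := c (a i) != c (b i).

Definition boltzmann w c : R := \prod_i (if disagree c i then w i else 1).

Definition partition_fn w : R := \sum_c boltzmann w c.

Definition cut_mass w i : R := \sum_(c | disagree c i) boltzmann w c.

Definition tilt w i (r : R) : I -> R := fun j => if j == i then w j * r else w j.

Lemma boltzmann_tilt w i r c :
  boltzmann (tilt w i r) c = (if disagree c i then r else 1) * boltzmann w c.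
Proof.
rewrite /boltzmann (bigD1 i) //= [in RHS](bigD1 i) //= mulrA /tilt eqxx.
congr (_ * _); first by case: ifP => _; rewrite ?mulr1 1?mulrC.
by apply: eq_bigr => j /negPf ->.
Qed.

Lemma sum_boltzmann_if w i (r t : R) :
  \sum_c (if disagree c i then r else t) * boltzmann w c
    = t * partition_fn w + (r - t) * cut_mass w i.
Proof.
rewrite /partition_fn /cut_mass !big_distrr /= [in X in _ + X]big_mkcond -big_split /=.
by apply: eq_bigr => c _; case: ifP => _; ring.
Qed.

(** [partition_fn] is affine in each edge weight, with slope given by [cut_mass]. *)
Lemma partition_fn_tilt w i r :
  partition_fn (tilt w i r) = partition_fn w + (r - 1) * cut_mass w i.
Proof.
rewrite -[X in X + _]mul1r -sum_boltzmann_if.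
by apply: eq_bigr => c _; rewrite boltzmann_tilt.
Qed.

Lemma boltzmann_ge0 w c : (forall i, 0 <= w i) -> 0 <= boltzmann w c.
Proof. by move=> w0; apply: prodr_ge0 => i _; case: ifP. Qed.

Lemma boltzmann_gt0 w c : (forall i, 0 < w i) -> 0 < boltzmann w c.
Proof. by move=> w0; apply: prodr_gt0 => i _; case: ifP. Qed.

Lemma cut_mass_ge0 w i : (forall i, 0 <= w i) -> 0 <= cut_mass w i.
Proof. by move=> w0; apply: sumr_ge0 => c _; exact: boltzmann_ge0. Qed.

Lemma cut_mass_le w i : (forall i, 0 <= w i <= 1) ->
  cut_mass w i <= w i * #|{ffun V -> F}|%:R.
Proof.
move=> w01; rewrite -sumr_const big_distrr /= /cut_mass big_mkcond /=.
apply: ler_sum => c _; rewrite mulr1; have /andP[wi0 wi1] := w01 i.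
case: ifP => // dis; rewrite /boltzmann (bigD1 i) //= dis.
rewrite ler_piMr // prodr_ile1 // => j _.
by case: ifP => _; [exact: w01 | rewrite ler01 lexx].
Qed.

Lemma partition_fn_ge1 w : (forall i, 0 <= w i) -> 1 <= partition_fn w.
Proof.
move=> w0; rewrite /partition_fn (bigD1 [ffun=> 0]) //=.
have -> : boltzmann w [ffun=> 0] = 1.
  by apply: big1 => i _; rewrite /disagree !ffunE eqxx.
by rewrite lerDl sumr_ge0 // => c _; exact: boltzmann_ge0.
Qed.

Definition flat s : {set {ffun V -> F}} :=
  [set c : {ffun V -> F} | all (fun i => ~~ disagree c i) s]%SET.

Lemma flatP s c :
  reflect (forall i, i \in s -> c (a i) = c (b i)) (c \in flat s).
Proof.
rewrite inE; apply: (iffP allP) => H i /H; first by move/negPn/eqP.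
by rewrite /disagree negbK => ->.
Qed.

(** The map [c |-> c (a i) - c (b i)] has at most [#|F|] nonempty fibres on a flat, and
subtracting a fixed member embeds each fibre into the flat where it vanishes. *)
Lemma card_flat_cons s i : (#|flat s| <= #|F| * #|flat (i :: s)|)%N.
Proof.
rewrite -sum1_card (partition_big (fun c => c (a i) - c (b i)) predT) //=.
rewrite -sum_nat_const; apply: leq_sum => t _; rewrite sum1_card.
set fibre := (X in #|X|).
have [c0 /andP[/flatP c0s /eqP c0t]|none] := pickP fibre; last by rewrite eq_card0.
rewrite -(card_imset fibre (addIr (- c0))).
apply/subset_leq_card/fintype.subsetP => _ /imsetP[c /andP[/flatP cs /eqP ct] ->].
apply/flatP => j; rewrite inE !ffunE => /predU1P[->|js]; last by rewrite cs // c0s.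
move/eqP: ct; rewrite subr_eq => /eqP ->; move/eqP: c0t; rewrite subr_eq => /eqP ->.
by ring.
Qed.

(** The factor of edge [i] is [w i] plus [1 - w i] times the indicator that [c] agrees
on [i]; the second term restricts the sum to a smaller flat.  Hence the induction on
the edges in [l] has to range over all flats. *)
Lemma flat_prod_ge s l w : (forall i, 0 <= w i <= 1) ->
  #|flat s|%:R * \prod_(i <- l) (w i + (1 - w i) / q)
    <= \sum_(c in flat s) \prod_(i <- l) (if disagree c i then w i else 1).
Proof.
move=> w01; elim: l s => [|i l IH] s.
  rewrite big_nil mulr1 -sumr_const.
  by under [X in _ <= X]eq_bigr => c _ do rewrite big_nil.
have /andP[wi0 wi1] := w01 i.
have q0 : 0 < q by rewrite ltr0n; apply/card_gt0P; exists 0.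
have P0 : 0 <= \prod_(j <- l) (w j + (1 - w j) / q).
  apply: prodr_ge0 => j _; have /andP[wj0 wj1] := w01 j.
  by rewrite addr_ge0 // divr_ge0 ?subr_ge0 // ltW.
have -> : \sum_(c in flat s) \prod_(j <- i :: l) (if disagree c j then w j else 1)
  = w i * \sum_(c in flat s) \prod_(j <- l) (if disagree c j then w j else 1)
  + (1 - w i) * \sum_(c in flat (i :: s))
                  \prod_(j <- l) (if disagree c j then w j else 1).
  rewrite !big_distrr /= [X in _ + X]big_mkcond /= [X in X + _]big_mkcond -big_split /=.
  rewrite big_mkcond; apply: eq_bigr => c _; rewrite big_cons !inE /=.
  by case: (disagree c i) => /=; case: ifP => _; ring.
rewrite big_cons mulrCA mulrDl.
apply: lerD; first by rewrite ler_wpM2l // IH.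
rewrite -!mulrA ler_wpM2l ?subr_ge0 //; apply: le_trans (IH (i :: s)).
rewrite mulrA ler_wpM2r // ler_pdivrMl //.
by rewrite -natrM ler_nat card_flat_cons.
Qed.

(** A correlation inequality: [w i + (1 - w i) / q] is the mean of the factor of edge
[i] under a uniform colouring, so the factors are positively correlated. *)
Lemma partition_fn_ge w : (forall i, 0 <= w i <= 1) ->
  #|F|%:R ^+ #|V| * \prod_i (w i + (1 - w i) / q) <= partition_fn w.
Proof.
move=> w01; have := @flat_prod_ge [::] (index_enum I) w w01.
have -> : flat [::] = [set: {ffun V -> F}]%SET by apply/setP => c; rewrite !inE.
rewrite cardsT card_ffun natrX; under [X in _ <= X]eq_bigl => c do rewrite inE.
exact.
Qed.

(** * Balanced edge weights *)

(** First-order conditions for a minimum of [ln Z + d * \sum_i lam i], up to factors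
[exp (+- s)].  Minimising over the multiples of [s] in a bounded range replaces
derivatives by comparisons with the two neighbouring grid points; raising [lam i]
gives the upper bound on the disagreement, lowering it the lower bound. *)
Lemma exists_balanced_weights (d s : R) : 0 < d -> 0 < s ->
  exists lam : I -> R, forall i, let w := fun j => expR (- lam j) in
    [/\ 0 <= lam i, cut_mass w i <= d * expR s * partition_fn w
      & 0 < lam i -> d * expR (- s) * partition_fn w <= cut_mass w i].
Proof.
move=> d0 s0; set N : R := #|{ffun V -> F}|%:R.
(* K is so large that exp (- s * K) * N <= d: an edge with parameter s * K
   satisfies the upper bound by cut_mass_le alone. *)
have [K KN] : exists K : nat, N / (d * s) <= K%:R.
  exists (Num.bound (N / (d * s))); apply/ltW/archi_boundP.
  by rewrite divr_ge0 // mulr_ge0 // ltW.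
pose wt (m : {ffun I -> 'I_K.+1}) j := expR (- (s * (m j)%:R)).
pose Phi m := partition_fn (wt m) * expR (d * s * \sum_j (m j)%:R).
pose move (m : {ffun I -> 'I_K.+1}) i k : {ffun I -> 'I_K.+1} :=
  [ffun j => if j == i then k else m j].
have wt_ge0 m j : 0 <= wt m j by exact: expR_ge0.
have wt_le1 m j : wt m j <= 1.
  by rewrite /wt expR_le1 oppr_le0 mulr_ge0 // ltW.
have wt_move m i k :
    wt (move m i k) = tilt (wt m) i (expR (s * ((m i)%:R - k%:R))).
  apply/funext => j; rewrite /wt /tilt ffunE; case: eqP => [->|//].
  by rewrite -expRD; congr expR; ring.
have sum_move m i k :
    \sum_j (move m i k j)%:R = \sum_j (m j)%:R + (k%:R - (m i)%:R) :> R.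
  rewrite (bigD1 i) //= [in RHS](bigD1 i) //= ffunE eqxx.
  under eq_bigr => j /negPf ji do rewrite ffunE ji.
  by ring.
have [m min_m] : exists m, forall m', Phi m <= Phi m'.
  case: (arg_minP (i0 := [ffun=> ord0]) (P := predT) Phi) => // m _ min_m.
  by exists m => m'; exact: min_m.
have Z0 : 0 < partition_fn (wt m).
  by apply: lt_le_trans ltr01 _; exact: partition_fn_ge1.
(* Optimality of m, after cancelling the common exponential factor. *)
have opt i (k : 'I_K.+1) : partition_fn (wt m) <= expR (d * s * (k%:R - (m i)%:R)) *
    (partition_fn (wt m) + (expR (s * ((m i)%:R - k%:R)) - 1) * cut_mass (wt m) i).
  have := min_m (move m i k).
  rewrite /Phi wt_move sum_move partition_fn_tilt.
  rewrite [d * s * (_ + _)]mulrDr [expR (_ + _)]expRD [X in _ <= X]mulrCA.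
  by rewrite mulrC ler_pM2l ?expR_gt0 // [X in _ <= X]mulrC.
have D0 i : 0 <= cut_mass (wt m) i / partition_fn (wt m).
  by apply: divr_ge0 (ltW Z0); exact: cut_mass_ge0.
have DE i : cut_mass (wt m) i
    = cut_mass (wt m) i / partition_fn (wt m) * partition_fn (wt m).
  by rewrite divfK // gt_eqF.
exists (fun j => s * (m j)%:R) => i /=; rewrite -/(wt m); split.
- by rewrite mulr_ge0 // ltW.
- have [lt_mK|ge_mK] := ltnP (m i) K.
    (* If the bound failed, raising m i by one would lower Phi. *)
    rewrite leNgt; apply/negP => big.
    have := opt i (inord (m i).+1); rewrite inordK //.
    have -> : (m i).+1%:R - (m i)%:R = 1 :> R by rewrite -natr1; ring.
    have -> : (m i)%:R - (m i).+1%:R = -1 :> R by rewrite -natr1; ring.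
    rewrite mulr1 mulrN1 leNgt => /negP; apply; rewrite [d * s]mulrC.
    apply: (chernoff_lower _ _ _ _ (cut_mass (wt m) i / partition_fn (wt m))) => //.
      by rewrite -DE.
    by rewrite expRN ltr_pdivlMr ?expR_gt0 // ltr_pdivlMr.
  apply: le_trans (cut_mass_le _ i _) _; first by move=> j; rewrite wt_ge0 wt_le1.
  rewrite [wt m i]/wt; have -> : m i = K :> nat.
    by apply/eqP; rewrite eqn_leq ge_mK -ltnS ltn_ord.
  apply: (@le_trans _ _ d).
    rewrite -/N expRN ler_pdivrMl ?expR_gt0 // -ler_pdivrMr //.
    apply: le_trans (_ : s * K%:R <= _); last first.
      by apply: le_trans (expR_ge1Dx _); rewrite lerDr.
    by rewrite [s * _]mulrC -ler_pdivrMr // -mulrA -invfM.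
  rewrite -mulrA; apply: ler_peMr (ltW d0) _; apply: mulr_ege1.
    by rewrite -expR0 ler_expR ltW.
  exact: partition_fn_ge1.
(* If the bound failed, lowering m i by one would lower Phi. *)
- rewrite pmulr_rgt0 // ltr0n => mi0; rewrite leNgt; apply/negP => small.
  have lt_mK : ((m i).-1 < K.+1)%N by rewrite (leq_ltn_trans (leq_pred _)).
  have := opt i (inord (m i).-1); rewrite inordK //.
  have -> : (m i).-1%:R - (m i)%:R = -1 :> R.
    by rewrite -[in X in _ - X](prednK mi0) -natr1; ring.
  have -> : (m i)%:R - (m i).-1%:R = 1 :> R.
    by rewrite -[in X in X - _](prednK mi0) -natr1; ring.
  rewrite mulr1 mulrN1 leNgt => /negP; apply; rewrite [d * s]mulrC.
  apply: (chernoff_upper _ _ _ _ (cut_mass (wt m) i / partition_fn (wt m))) => //.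
    by rewrite -DE.
  by rewrite -ltr_pdivlMr ?expR_gt0 // -expRN ltr_pdivrMr.
Qed.

(** * Counting maps with short edges *)

Definition colours_map {n} (y : {ffun 'I_n -> {ffun V -> F}}) : {ffun V -> 'rV[F]_n} :=
  [ffun u => \row_k y k u].

Lemma colours_map_inj n : injective (@colours_map n).
Proof.
move=> y z /ffunP yz; apply/ffunP => k; apply/ffunP => u.
by have := yz u; rewrite !ffunE => /rowP/(_ k); rewrite !mxE.
Qed.

Lemma hamming_colours_map n (y : {ffun 'I_n -> {ffun V -> F}}) i :
  hamming (colours_map y (a i)) (colours_map y (b i))
    = (\sum_k disagree (y k) i)%N.
Proof.
rewrite /hamming -sum1_card big_mkcond /=; apply: eq_bigr => k _.
by rewrite inE !ffunE !mxE /disagree; case: ifP.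
Qed.

Definition close_injections (delta : R) n : {set {ffun V -> 'rV[F]_n}} :=
  [set x : {ffun V -> 'rV[F]_n} | injectiveb x
     & [forall i, (hamming (x (a i)) (x (b i)))%:R < delta * n%:R]]%SET.

Lemma sum_collision w u v : (forall i, 0 < w i) -> u != v ->
  \sum_(c : {ffun V -> F}) (c u == c v)%:R * boltzmann w c < partition_fn w.
Proof.
move=> w0 uv; pose c0 : {ffun V -> F} := [ffun z => (z == u)%:R].
have c0uv : c0 u == c0 v = false.
  by rewrite !ffunE eqxx [v == u]eq_sym (negPf uv) oner_eq0.
rewrite /partition_fn (bigD1 c0) //= [X in _ < X](bigD1 c0) //= c0uv mul0r add0r.
rewrite ltr_pwDl ?boltzmann_gt0 //; apply: ler_sum => c _.
have := boltzmann_gt0 w c w0; case: eqP => _; rewrite ?mul1r ?mul0r // => /ltW //.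
Qed.

(** For the balanced weights, avoided events are: an edge of length at least
[delta * n], an edge with [lam i > 0] of length at most [theta * delta * n], and a
collision of two vertices.  The bounds [delta * exp (- s)] and
[delta * exp (- 3 * s)] on the disagreement probability leave room [s] on a
logarithmic scale on either side, of which the moments with [t = s / 2] use half. *)
Lemma many_close_injections (delta s : R) : 0 < delta < 1 -> 0 < s ->
  \forall n \near \oo,
    expR (n%:R * (#|V|%:R * ln q + #|I|%:R * (expR (- (4 * s)) *
      (- (1 - delta) * ln (1 - delta) - delta * ln (delta / (q - 1))) - ln q))) / 2
    <= #|close_injections delta n|%:R.
Proof.
move=> /[dup] d01 /andP[d0 d1] s0; set h := - (1 - delta) * _ - _.
have q1 : 1 < q by rewrite ltr1n card_finNzRing_gt1.
have de0 : 0 < delta * expR (- (2 * s)) by rewrite mulr_gt0 ?expR_gt0.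
(* Aiming at exp (- 2 * s) * delta keeps even the upper bound on the disagreement
   probability, larger by exp s, strictly below delta. *)
have [lam balanced] := exists_balanced_weights _ _ de0 s0.
pose w j := expR (- lam j); pose Z := partition_fn w.
pose theta := expR (- (4 * s)); pose kappa := theta * delta.
pose t := s / 2.
have t0 : 0 < t by rewrite divr_gt0.
have lam_ge0 i : 0 <= lam i by have [] := balanced i.
have upper i : cut_mass w i <= delta * expR (- s) * Z.
  have [_ + _] := balanced i; rewrite -/w -/Z -[delta * _ * _]mulrA -expRD.
  by have -> : - (2 * s) + s = - s by ring.
have lower i : 0 < lam i -> delta * expR (- (3 * s)) * Z <= cut_mass w i.
  move=> li; have [_ _ /(_ li)] := balanced i.
  rewrite -/w -/Z -[delta * _ * _]mulrA -expRD.
  by have -> : - (2 * s) - s = - (3 * s) by ring.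
have w0 j : 0 < w j by exact: expR_gt0.
have w1 j : w j <= 1 by rewrite /w expR_le1 oppr_le0.
have Z1 : 1 <= Z by apply: partition_fn_ge1 => j; exact: ltW.
have Z0 : 0 < Z by exact: lt_le_trans Z1.
(* Where there is nothing to avoid (an edge with lam i = 0, a pair of equal
   vertices), the moment is set to zero. *)
pose gup i (c : {ffun V -> F}) := expR (t * ((disagree c i)%:R - delta)).
pose glow i (c : {ffun V -> F}) :=
  if 0 < lam i then expR (t * (kappa - (disagree c i)%:R)) else 0.
pose gcol (uv : V * V) (c : {ffun V -> F}) : R :=
  if uv.1 != uv.2 then (c uv.1 == c uv.2)%:R else 0.
pose g (j : I + I + V * V) :=
  match j with inl (inl i) => gup i | inl (inr i) => glow i | inr uv => gcol uv end.
have g0 j c : 0 <= g j c.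
  case: j => [[i|i]|uv] /=; first exact: expR_ge0.
    by rewrite /glow; case: ifP => // _; exact: expR_ge0.
  by rewrite /gcol; case: ifP.
have gZ j : \sum_c g j c * boltzmann w c < Z.
  case: j => [[i|i]|uv] /=.
  - under eq_bigr => c _.
      have -> : gup i c = if disagree c i then expR (- (t * delta)) * expR t
                          else expR (- (t * delta)).
        by rewrite /gup -expRD; case: ifP => _ /=; congr expR; ring.
      over.
    rewrite sum_boltzmann_if -/Z.
    have -> : forall x y D : R, x * Z + (x * y - x) * D = x * (Z + (y - 1) * D).
      by move=> *; ring.
    apply: (chernoff_upper _ _ _ _ (delta * expR (- s))) => //.
      by rewrite mulr_ge0 ?expR_ge0 // ltW.
    by rewrite -mulrA -expRD gtr_pMr // expR_lt1 /t; lra.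
  - rewrite /glow; case: (boolP (0 < lam i)) => li; last first.
      by under eq_bigr => c _ do rewrite mul0r; rewrite big1.
    under eq_bigr => c _.
      have -> : expR (t * (kappa - (disagree c i)%:R))
          = if disagree c i then expR (t * kappa) * expR (- t) else expR (t * kappa).
        by rewrite -expRD; case: ifP => _ /=; congr expR; ring.
      over.
    rewrite sum_boltzmann_if -/Z.
    have -> : forall x y D : R, x * Z + (x * y - x) * D = x * (Z + (y - 1) * D).
      by move=> *; ring.
    apply: (chernoff_lower _ _ _ _ (delta * expR (- (3 * s)))) => //.
    + by rewrite mulr_ge0 ?expR_ge0 // ltW.
    + exact: lower.
    rewrite -mulrA -expRD /kappa mulrC ltr_pM2l // /theta ltr_expR /t; lra.
  - rewrite /gcol; case: (boolP (uv.1 != uv.2)) => uv12; first exact: sum_collision.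
    by under eq_bigr => c _ do rewrite mul0r; rewrite big1.
have W0 c : 0 <= boltzmann w c by apply: boltzmann_ge0 => j; exact: ltW.
have := typical_mass R _ _ (boltzmann w) g W0 g0 Z0 gZ.
apply: filterS => n; rewrite -/(partition_fn w) -/Z => mass.
pose d (y : {ffun 'I_n -> {ffun V -> F}}) i := (\sum_k disagree (y k) i)%N.
have sum_dis (al be : R) (y : {ffun 'I_n -> {ffun V -> F}}) i :
    \sum_k (al + be * (disagree (y k) i)%:R) = al * n%:R + be * (d y i)%:R.
  by rewrite big_split /= sumr_const card_ord mulr_natr -big_distrr /= natr_sum.
have typ_close (y : {ffun 'I_n -> {ffun V -> F}}) :
    typical g y -> colours_map y \in close_injections delta n.
  move=> /forallP typ; rewrite inE; apply/andP; split.
    apply/injectiveP => u v uv; apply/eqP; apply: contraT => neq.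
    have := typ (inr (u, v)); rewrite /= big1 ?ltxx // => k _.
    move: uv; rewrite !ffunE => /rowP/(_ k); rewrite !mxE => uv.
    by rewrite /gcol neq uv eqxx.
  apply/forallP => i; rewrite hamming_colours_map -/(d y i).
  have := typ (inl (inl i)); rewrite /= /gup -expR_sum expR_lt1.
  under eq_bigr => k _ do rewrite mulrBr addrC.
  rewrite sum_dis.
  have -> : - (t * delta) * n%:R + t * (d y i)%:R
      = t * ((d y i)%:R - delta * n%:R) by ring.
  by rewrite pmulr_rlt0 // subr_lt0.
(* Each edge contributes exp (- lam i) per disagreement, and a typical sequence has
   more than kappa * n of them as soon as lam i > 0. *)
have typ_weight (y : {ffun 'I_n -> {ffun V -> F}}) : typical g y ->
    \prod_k boltzmann w (y k) <= expR (- (n%:R * kappa * \sum_i lam i)).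
  move=> /forallP typ; rewrite exchange_big /= big_distrr /= -sumrN expR_sum.
  apply: ler_prod => i _.
  have -> : \prod_(k < n) (if disagree (y k) i then w i else 1)
      = expR (- lam i * (d y i)%:R).
    rewrite -[_ * _]add0r -[X in X + _](mul0r n%:R) -sum_dis expR_sum.
    apply: eq_bigr => k _; rewrite add0r.
    by case: ifP => _ /=; rewrite ?mulr1 // mulr0 expR0.
  rewrite expR_ge0 ler_expR /= mulNr lerN2 [X in X <= _]mulrC.
  have := lam_ge0 i; rewrite le_eqVlt => /predU1P[<-|li]; first by rewrite !mul0r.
  rewrite ler_pM2l // mulrC ltW //.
  have := typ (inl (inr i)); rewrite /= /glow li -expR_sum expR_lt1.
  under eq_bigr => k _ do rewrite mulrBr -mulNr.
  rewrite sum_dis.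
  have -> : t * kappa * n%:R + - t * (d y i)%:R = t * (kappa * n%:R - (d y i)%:R) by ring.
  by rewrite pmulr_rlt0 // subr_lt0.
have card_ge : Z ^+ n / 2 * expR (n%:R * kappa * \sum_i lam i)
    <= #|close_injections delta n|%:R.
  rewrite -[X in _ * expR X]opprK expRN ler_pdivrMr ?expR_gt0 //.
  apply: le_trans mass _; apply: (@le_trans _ _
    (\sum_(y | typical g y) expR (- (n%:R * kappa * \sum_i lam i)))).
    exact: ler_sum.
  rewrite sumr_const -[_ *+ _]mulr_natl ler_wpM2r ?expR_ge0 // ler_nat.
  rewrite -(card_imset _ (colours_map_inj n)); apply: subset_leq_card.
  by apply/fintype.subsetP => _ /imsetP[y typ ->]; exact: typ_close.
(* What is left is an inequality between n-th powers, hence one for n = 1, and it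
   splits into one factor per edge. *)
apply: le_trans card_ge; rewrite mulrAC ler_pM2r // -[n%:R * kappa * _]mulrA.
rewrite !expRM_natl -exprMn lerXn2r ?nnegrE ?expR_ge0 //.
  by rewrite mulr_ge0 ?expR_ge0 // ltW.
have := partition_fn_ge w (fun i => introT andP (conj (ltW (w0 i)) (w1 i))).
rewrite -/Z => Zge.
apply: (@le_trans _ _ (_ * expR (kappa * \sum_i lam i))); last first.
  by apply: ler_wpM2r Zge; exact: expR_ge0.
rewrite expRD expRM_natl lnK ?posrE ?(lt_trans ltr01) // -mulrA.
rewrite ler_wpM2l ?exprn_ge0 ?ler0n //.
rewrite big_distrr /= expR_sum -big_split /= expRM_natl -prodr_const.
apply: ler_prod => i _; rewrite expR_ge0 /=.
by apply: edge_factor_ge => //; rewrite expR_ge0 /= /theta expR_le1; lra.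
Qed.

End Potts.

(** * The exponent *)

(** An orientation of the edges, which are unordered pairs. *)
Lemma edge_ends (H : sgraph) :
  exists ends : {A : {set H} | A \in edges H} -> H * H,
    forall x y : H, adj x y ->
      exists i, (x = (ends i).1 /\ y = (ends i).2) \/ (x = (ends i).2 /\ y = (ends i).1).
Proof.
have endsP (i : {A : {set H} | A \in edges H}) :
    exists p : H * H, val i = [set p.1; p.2]%SET.
  by have /imsetP[p _ ->] := valP i; exists p.
have [ends endsE] := choice endsP; exists ends => x y xy.
have xyE : [set x; y]%SET \in edges H by apply/imsetP; exists (x, y); rewrite ?inE.
pose A : {A : {set H} | A \in edges H} := Sub [set x; y]%SET xyE.
exists A; have := endsE A; rewrite SubK; move: (ends _) => [u v] /= e.
have := set22 x y; have := set21 x y; rewrite e !inE.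
have xNy : x != y by apply: contraTneq xy => ->; rewrite adj_irr.
move=> /orP[]/eqP ex /orP[]/eqP ey.
- by rewrite ex ey eqxx in xNy.
- by left.
- by right.
- by rewrite ex ey eqxx in xNy.
Qed.

(** The parameter [s] of [many_close_injections] costs at most [e / 2] in the exponent,
and the factor [1 / 2] another [e / 2] once [n] is large. *)
Lemma inj_num_ge (R : realType) (q : nat) (F : finFieldType) (delta : R)
    (H : sgraph) (e : R) : #|F| = q -> 0 < delta < 1 -> 0 < e ->
  \forall n \near \oo,
    expR (n%:R * (ln q%:R * ((numv H)%:R - (nume H)%:R
                              + (nume H)%:R * hq q delta - e)))
      <= (inj_num H (proximity F delta n))%:R :> R.
Proof.
move=> cardF d01 e0.
have q1 : 1 < q%:R :> R by rewrite -cardF ltr1n card_finNzRing_gt1.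
have lnq0 : 0 < ln q%:R :> R by rewrite ln_gt0.
have [ends endsP] := edge_ends H.
pose E : R := (nume H)%:R; pose h := hq q delta.
(* With this s the entropy loss (1 - exp (- 4 * s)) * E * h is at most e / 2. *)
pose s := e / (8 * (E * `|h| + 1)).
have E0 : 0 <= E by rewrite ler0n.
have den0 : 0 < E * `|h| + 1 by rewrite ltr_wpDl // mulr_ge0.
have s0 : 0 < s by rewrite divr_gt0 // mulr_gt0.
have hE : - (1 - delta) * ln (1 - delta) - delta * ln (delta / (q%:R - 1))
    = h * ln q%:R.
  by rewrite /h /hq /logb; field; rewrite gt_eqF.
have cardI : #|{: {A : {set H} | A \in edges H}}| = nume H by rewrite card_sig.
have loss : E * h - E * (expR (- (4 * s)) * h) <= e / 2.
  have th1 : expR (- (4 * s)) <= 1 by rewrite expR_le1 oppr_le0 mulr_ge0 // ltW.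
  have thge := expR_ge1Dx (- (4 * s)).
  have -> : E * h - E * (expR (- (4 * s)) * h) = (1 - expR (- (4 * s))) * (E * h) by ring.
  apply: (@le_trans _ _ (4 * s * (E * `|h| + 1))); last first.
    rewrite le_eqVlt /s; apply/orP; left; apply/eqP; field; rewrite gt_eqF //.
  apply: (@le_trans _ _ ((1 - expR (- (4 * s))) * (E * `|h|))).
    by rewrite !ler_wpM2l ?subr_ge0 ?ler_norm.
  apply: ler_pM; rewrite ?subr_ge0 // ?mulr_ge0 //; lra.
have := many_close_injections R F H {A : {set H} | A \in edges H}
  (fun i => (ends i).1) (fun i => (ends i).2) delta s d01 s0.
rewrite cardF cardI hE -/E.
apply: filterS2 (nbhs_infty_ger (ln 2 / (ln q%:R * (e / 2)))) => n nbig many.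
apply: (@le_trans _ _ _ _ _ _ (le_trans many _)).
  have half : (2 : R)^-1 = expR (- ln 2) by rewrite expRN lnK ?posrE.
  rewrite half -expRD ler_expR.
  move: nbig; rewrite ler_pdivrMr; last by rewrite !mulr_gt0 // invr_gt0.
  move=> nbig; rewrite -/h -/E /numv.
  set v : R := #|H|%:R; set L := ln q%:R; set th := expR _.
  have -> : n%:R * (v * L + E * (th * (h * L) - L)) - ln 2
     = n%:R * (L * (v - E + E * h - e)) + (n%:R * L * (e / 2 - (E * h - E * (th * h))))
       + (n%:R * (L * (e / 2)) - ln 2) by field.
  by rewrite -[X in _ <= X]addrA lerDl addr_ge0 ?subr_ge0 // !mulr_ge0 ?subr_ge0 // ltW.
rewrite ler_nat /inj_num; apply/subset_leq_card/fintype.subsetP => x.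
rewrite !inE => /andP[x_inj /forallP close]; rewrite x_inj /=.
apply/forallP => u; apply/forallP => u'; apply/implyP => uu'.
have uNu' : u != u' by apply: contraTneq uu' => ->; rewrite adj_irr.
apply/andP; split; first by apply: contra_neq uNu'; exact: (injectiveP _ x_inj).
have [i [[-> ->]|[-> ->]]] := endsP _ _ uu'; first exact: close.
by rewrite hammingC; exact: close.
Qed.

Theorem theorem15 (R : realType) (q : nat) (q_pp : prime_power q)
    (F : finFieldType) (cardF : #|F| = q)
    (delta : R) (delta_gt0 : 0 < delta) (delta_le : delta <= 1 - q%:R^-1)
    (H : sgraph) :
  exists eps : nat -> R,
    (eps n @[n --> \oo] --> (0 : R)) /\
    (\forall n \near \oo,
      (inj_num H (proximity F delta n))%:R >=
      (q%:R ^+ n) `^ ((numv H)%:R - (nume H)%:R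
                      + (nume H)%:R * hq q delta + eps n)).
Proof.
have q1 : 1 < q%:R :> R by rewrite -cardF ltr1n card_finNzRing_gt1.
have q0 : 0 < q%:R :> R by exact: lt_trans q1.
have lnq0 : 0 < ln q%:R :> R by rewrite ln_gt0.
have d01 : 0 < delta < 1.
  by rewrite delta_gt0 (le_lt_trans delta_le) // gtrBl invr_gt0.
set M : R := _ + _ * hq q delta.
pose N n : R := (inj_num H (proximity F delta n))%:R.
have near_inj e : 0 < e ->
    \forall n \near \oo, expR (n%:R * (ln q%:R * (M - e))) <= N n.
  exact: inj_num_ge.
(* The largest nonpositive error for which the bound holds. *)
pose eps n := Num.min 0 (ln (N n) / (n%:R * ln q%:R) - M).
exists eps; split.
  apply/cvgrPdist_le => e e0.
  apply: filterS2 (nbhs_infty_gt 0) (near_inj e e0) => n n0 Ne.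
  have nL0 : 0 < n%:R * ln q%:R :> R by rewrite mulr_gt0 // ltr0n.
  have N0 : 0 < N n by apply: lt_le_trans Ne; exact: expR_gt0.
  rewrite sub0r normrN ler0_norm; last by rewrite ge_min lexx.
  rewrite lerNl le_min oppr_le0 ltW //= lerBrDr ler_pdivlMr //.
  by rewrite -ler_expR lnK ?posrE // mulrC -mulrA addrC.
apply: filterS2 (nbhs_infty_gt 0) (near_inj 1 ltr01) => n n0 N1.
have nL0 : 0 < n%:R * ln q%:R :> R by rewrite mulr_gt0 // ltr0n.
have N0 : 0 < N n by apply: lt_le_trans N1; exact: expR_gt0.
rewrite /powR gt_eqF ?exprn_gt0 // lnXn // -[ln _ *+ n]mulr_natl -/(N n).
rewrite -[X in _ <= X]lnK ?posrE // ler_expR -ler_pdivlMr // addrC -lerBrDr.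
by rewrite /eps ge_min lexx orbT.
Qed.
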